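(* For any integers $n,d\ge1$ and any vectors $X_1,\dots,X_n\in\mathbb{R}^d$, the stochastic binary quantization protocol $\pi_{sb}$ satisfies $$\mathcal{E}(\pi_{sb},X^n)\;\le\;\frac{d}{2n}\cdot\frac1n\sum_{i=1}^n\|X_i\|_2^2 .$$
   Context: $X^n=(X_1,\dots,X_n)$, $\bar X=\frac1n\sum_iX_i$, $X_i^{\max}=\max_jX_i(j)$, $X_i^{\min}=\min_jX_i(j)$. In stochastic binary quantization $\pi_{sb}$, independently for all $i,j$, $Y_i(j)=X_i^{\max}$ with probability $\frac{X_i(j)-X_i^{\min}}{X_i^{\max}-X_i^{\min}}$ and $Y_i(j)=X_i^{\min}$ otherwise (if $X_i^{\max}=X_i^{\min}$, $Y_i=X_i$). The server's estimate is $\hat{\bar X}=\frac1n\sum_{i=1}^nY_i$, and $\mathcal{E}(\pi_{sb},X^n)=\mathbb{E}\|\hat{\bar X}-\bar X\|_2^2$. *)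

(* Defs.v *)
From HB Require Import structures.
From mathcomp Require Import all_boot all_order all_algebra.
From mathcomp Require Import all_classical all_reals all_analysis.

Set Implicit Arguments.
Unset Strict Implicit.
Unset Printing Implicit Defensive.

Import Order.TTheory GRing.Theory Num.Theory.

Local Open Scope classical_set_scope.
Local Open Scope ring_scope.

(* The library norm on 'rV[R]_d is the sup norm, hence a separate definition. *)
Definition l2norm (R : realType) (d : nat) (x : 'rV[R]_d) : R :=
  Num.sqrt (\sum_(j < d) x ord0 j ^+ 2).

(* [hd] provides a first coordinate, so that the iterated max (resp. min) is
   seeded with an actual entry of [x] and not with a default value. *)
Definition vmax (R : realType) (d : nat) (hd : (1 <= d)%N) (x : 'rV[R]_d) : R :=
  \big[Num.max/x ord0 (Ordinal hd)]_(j < d) x ord0 j.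

Definition vmin (R : realType) (d : nat) (hd : (1 <= d)%N) (x : 'rV[R]_d) : R :=
  \big[Num.min/x ord0 (Ordinal hd)]_(j < d) x ord0 j.

Definition vmean (R : realType) (n d : nat) (X : 'I_n -> 'rV[R]_d) : 'rV[R]_d :=
  n%:R^-1 *: \sum_(i < n) X i.

(* Mutual (not merely pairwise) independence: product rule over every
   subfamily and all Borel sets. *)
Definition mutually_independent (dT : measure_display) (T : measurableType dT)
    (R : realType) (P : probability T R) (I : finType)
    (Z : I -> {RV P >-> R}) : Prop :=
  forall (J : {set I}) (B : I -> set R),
    (forall k, measurable (B k)) ->
    P (\bigcap_(k in [set` J]) (Z k @^-1` B k)) =
    (\prod_(k in J) P (Z k @^-1` B k))%E.

(* [Y] is an output of stochastic binary quantization on the inputs [X], on an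
   arbitrary probability space: [Y i j] is the quantized [X i ord0 j].  Only
   the joint law of [Y] is prescribed. *)
Definition stochastic_binary_quantization
    (dT : measure_display) (T : measurableType dT)
    (R : realType) (P : probability T R) (n d : nat) (hd : (1 <= d)%N)
    (X : 'I_n -> 'rV[R]_d) (Y : 'I_n -> 'I_d -> {RV P >-> R}) : Prop :=
  mutually_independent (fun ij : 'I_n * 'I_d => Y ij.1 ij.2) /\
  forall (i : 'I_n) (j : 'I_d),
    let M := vmax hd (X i) in
    let m := vmin hd (X i) in
    if M == m then P [set w | Y i j w = X i ord0 j] = 1%E
    else
      let p := (X i ord0 j - m) / (M - m) in
      P [set w | Y i j w = M] = p%:E /\ P [set w | Y i j w = m] = (1 - p)%:E.

Definition server_estimate
    (dT : measure_display) (T : measurableType dT)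
    (R : realType) (P : probability T R) (n d : nat)
    (Y : 'I_n -> 'I_d -> {RV P >-> R}) (w : T) : 'rV[R]_d :=
  vmean (fun i : 'I_n => \row_(j < d) Y i j w).

Definition mean_squared_error
    (dT : measure_display) (T : measurableType dT)
    (R : realType) (P : probability T R) (n d : nat)
    (X : 'I_n -> 'rV[R]_d) (est : T -> 'rV[R]_d) : \bar R :=
  expectation P (fun w => l2norm (est w - vmean X) ^+ 2).

(* Main.v *)
(* Almost surely Y_i(j) = m + (M - m) 1_A, where M and m are the extreme
   coordinates of X_i and (M - m) P(A) = X_i(j) - m; this also covers M = m.  So
   each error Y_i(j) - X_i(j) is a centred indicator scaled by M - m.  By
   independence the cross terms of the squared error vanish, and each diagonal
   term is (M - m)^2 p (1 - p) <= (M - m)^2 / 4 <= (M^2 + m^2) / 2, which is at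
   most |X_i|^2 / 2 because M and m sit at distinct coordinates unless M = m. *)
Require Import Defs.
From HB Require Import structures.
From mathcomp Require Import all_boot all_order all_algebra.
From mathcomp Require Import all_classical all_reals all_analysis.
From mathcomp Require Import measurable_realfun ring lra.

Set Implicit Arguments.
Unset Strict Implicit.
Unset Printing Implicit Defensive.

Import Order.TTheory GRing.Theory Num.Theory.

Local Open Scope classical_set_scope.
Local Open Scope ring_scope.

Section bernoulli_noise.
Context (dT : measure_display) (T : measurableType dT) (R : realType)
  (P : probability T R).

(** Bounded by [(1 + |p|) * (1 + |q|)] on a space of finite measure. Integrability is what later
    allows signed sums and scalars to leave the integral. *)
Lemma centered_indic_prod_integrable (A B : set T) (p q : R) :
  measurable A -> measurable B ->
  P.-integrable setT (fun w => ((\1_A w - p) * (\1_B w - q))%:E).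
Proof.
move=> mA mB; apply: measurable_bounded_integrable => //.
- by rewrite (le_lt_trans (probability_le1 P measurableT)) ?ltry.
- by apply: measurable_funM; apply: measurable_funB => //;
    exact: measurable_indic.
- exists ((1 + `|p|) * (1 + `|q|)); split; first exact: num_real.
  move=> M ltM w _ /=; apply: le_trans (ltW ltM); rewrite normrM.
  by apply: ler_pM => //; apply: (le_trans (ler_normB _ _));
    rewrite lerD2r indicE ger0_norm ?ler0n // lern1 leq_b1.
Qed.

Lemma covariance_indic (A B : set T) : measurable A -> measurable B ->
  covariance P \1_A \1_B = (P (A `&` B) - P A * P B)%E.
Proof.
move=> mA mB.
have L1 C : measurable C -> (\1_C : T -> R) \in Lfun P 1.
  by move=> mC; apply/Lfun1_integrable; exact: integrable_indic.
have mulI : (\1_A * \1_B)%R = \1_(A `&` B) :> (T -> R) by rewrite indicI.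
rewrite covarianceE ?mulI ?L1//; last exact: measurableI.
by rewrite !expectation_indic//; exact: measurableI.
Qed.

(** The left side is the covariance of the two indicators, their means being the probabilities of
    the events. *)
Lemma expectation_centered_indic_prod (A B : set T) :
  measurable A -> measurable B ->
  expectation P (fun w => (\1_A w - fine (P A)) * (\1_B w - fine (P B))) =
  (P (A `&` B) - P A * P B)%E.
Proof.
move=> mA mB; rewrite -covariance_indic// covariance.unlock.
by rewrite !expectation_indic.
Qed.

(** The square expands into a double sum of covariances: those off the diagonal vanish by pairwise
    independence, and the diagonal leaves the Bernoulli variances [p * (1 - p)]. *)
Lemma second_moment_centered_indic_sum (I : finType) (A : I -> set T)
    (a : I -> R) (mA : forall i, measurable (A i))
    (indepA : forall i k, i != k -> P (A i `&` A k) = (P (A i) * P (A k))%E) :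
  expectation P (fun w => (\sum_i a i * (\1_(A i) w - fine (P (A i)))) ^+ 2) =
  (\sum_i a i ^+ 2 * (fine (P (A i)) * (1 - fine (P (A i)))))%:E.
Proof.
pose f i w : R := \1_(A i) w - fine (P (A i)).
have ff i k : expectation P (fun w => f i w * f k w) =
    (if i == k then fine (P (A i)) * (1 - fine (P (A i))) else 0)%:E.
  rewrite expectation_centered_indic_prod//.
  have PE l : P (A l) = (fine (P (A l)))%:E by rewrite fineK ?fin_num_measure.
  have [<-|ik] := eqVneq i k; last first.
    by rewrite indepA// subee// fin_numM ?fin_num_measure.
  by rewrite setIid PE -EFinM -EFinB mulrBr mulr1.
have -> : (fun w => (\sum_i a i * (\1_(A i) w - fine (P (A i)))) ^+ 2) =
    (fun w => \sum_i \sum_k a i * a k * (f i w * f k w)).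
  apply/funext => w; rewrite expr2 big_distrlr/=.
  by apply: eq_bigr => i _; apply: eq_bigr => k _; rewrite /f; ring.
rewrite expectation.unlock.
have iff i k : P.-integrable setT (fun w => (a i * a k * (f i w * f k w))%:E).
  under eq_fun do rewrite EFinM.
  by apply: integrableZl => //; exact: centered_indic_prod_integrable.
under eq_integral do rewrite -sumEFin.
under eq_integral do under eq_bigr do rewrite -sumEFin.
rewrite integral_sum//; last by move=> i; exact: integrable_sum.
rewrite -sumEFin; apply: eq_bigr => i _; rewrite integral_sum//.
rewrite (bigD1 i)//= big1 ?adde0 => [|k ki].
  under eq_integral do rewrite EFinM.
  rewrite integralZl//; last exact: centered_indic_prod_integrable.
  have := ff i i; rewrite expectation.unlock eqxx => ->.
  by rewrite -EFinM expr2.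
under eq_integral do rewrite EFinM.
rewrite integralZl//; last exact: centered_indic_prod_integrable.
have := ff i k; rewrite expectation.unlock eq_sym (negbTE ki) => ->.
by rewrite mule0.
Qed.

(** The events [Y = a] and [Y = b] are disjoint with total mass 1, so the complement of their union
    is a null set. *)
Lemma two_valued_ae (Y : {RV P >-> R}) (a b p : R) : a != b ->
  P [set w | Y w = a] = p%:E -> P [set w | Y w = b] = (1 - p)%:E ->
  {ae P, forall w, Y w = b + (a - b) * \1_[set w | Y w = a] w}.
Proof.
move=> ab Pa Pb.
pose A c : set T := [set w | Y w = c].
have mA c : measurable (A c).
  by have := @measurable_funPTI _ _ _ _ Y [set c] (measurable_set1 c).
have PAa : P (A a) = p%:E by [].
have PAb : P (A b) = (1 - p)%:E by [].
exists (~` (A a `|` A b)); split.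
- by apply: measurableC; exact: measurableU.
- suff PU : P (A a `|` A b) = 1%E.
    by rewrite probability_setC ?PU ?subee//; exact: measurableU.
  transitivity (P (A a) + P (A b))%E; last by rewrite PAa PAb -EFinD subrKC.
  apply: measureU => //; apply/seteqP; split=> w //= [Ya Yb].
  by case/eqP: ab; exact: etrans (esym Ya) Yb.
- apply: subsetC => w; case=> Yw; have {}Yw : Y w = _ := Yw;
    rewrite /= Yw indicE.
  + by rewrite mem_set// mulr1 subrKC.
  + by rewrite memNset ?mulr0 ?addr0//= Yw => /esym/eqP; rewrite (negbTE ab).
Qed.

End bernoulli_noise.

Section extreme_coordinates.
Context (R : realType) (d : nat) (hd : (1 <= d)%N) (x : 'rV[R]_d).

(** Being a coordinate of [x] holds for the seed and is preserved by a binary maximum. *)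
Lemma vmax_attained : exists j, vmax hd x = x ord0 j.
Proof.
rewrite /vmax; elim/big_ind: _ => [|_ _ [j ->] [k ->]|j _];
  [by eexists| |by exists j].
by rewrite /Num.max; case: ifP; eexists.
Qed.

Lemma vmin_attained : exists j, vmin hd x = x ord0 j.
Proof.
rewrite /vmin; elim/big_ind: _ => [|_ _ [j ->] [k ->]|j _];
  [by eexists| |by exists j].
by rewrite /Num.min; case: ifP; eexists.
Qed.

Lemma l2norm_sqr : l2norm x ^+ 2 = \sum_j x ord0 j ^+ 2.
Proof. by rewrite sqr_sqrtr// sumr_ge0// => j _; exact: sqr_ge0. Qed.

Lemma range_sqr_le : (vmax hd x - vmin hd x) ^+ 2 <= 2 * l2norm x ^+ 2.
Proof.
rewrite l2norm_sqr; have [j ->] := vmax_attained; have [k ->] := vmin_attained.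
(* If the indices coincide, the sum contains this square only once, but the range is then 0. *)
have [->|jk] := eqVneq j k.
  by rewrite subrr expr0n mulr_ge0// sumr_ge0// => i _; exact: sqr_ge0.
rewrite (bigD1 j)//= (bigD1 k) 1?eq_sym//= addrA.
set S := \sum_(_ | _) _.
have S0 : 0 <= S by rewrite sumr_ge0// => i _; exact: sqr_ge0.
(* With a and b the two extreme coordinates, 2(a^2 + b^2) - (a - b)^2 = (a + b)^2. *)
by have := sqr_ge0 (x ord0 j + x ord0 k); nra.
Qed.

End extreme_coordinates.

Section quantization.
Context (dT : measure_display) (T : measurableType dT) (R : realType)
  (P : probability T R).

Lemma mutually_independent_pair (I : finType) (Z : I -> {RV P >-> R}) i k
    (B C : set R) :
  mutually_independent Z -> i != k -> measurable B -> measurable C ->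
  P (Z i @^-1` B `&` Z k @^-1` C) = (P (Z i @^-1` B) * P (Z k @^-1` C))%E.
Proof.
move=> indepZ ik mB mC.
have ki : (k == i) = false by rewrite eq_sym (negbTE ik).
(* The product rule for the subfamily [{i, k}]; within it, the [else] branch concerns [k] alone. *)
have := indepZ [set i; k]%SET (fun l => if l == i then B else C).
rewrite big_setU1 ?inE//= big_set1 eqxx ki => <-; last by move=> l; case: ifP.
congr (P _); apply/seteqP; split=> w /=.
  by move=> [ZB ZC] l /=; rewrite !inE => /orP[]/eqP->; rewrite ?eqxx ?ki.
move=> Zw; split.
  by have := Zw i; rewrite /= !inE eqxx; apply.
by have := Zw k; rewrite /= !inE eqxx orbT ki; apply.
Qed.

(** Centring at [fine (P A)] instead of the quotient [(X i ord0 j - m) / (M - m)] gives one formula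
    for both cases: when [M = m], both sides are almost surely 0. *)
Lemma quantization_ae (n d : nat) (hd : (1 <= d)%N) (X : 'I_n -> 'rV[R]_d)
    (Y : 'I_n -> 'I_d -> {RV P >-> R}) i j :
  stochastic_binary_quantization hd X Y ->
  let M := vmax hd (X i) in let m := vmin hd (X i) in
  let A : set T := Y i j @^-1` [set M] in
  {ae P, forall w, Y i j w - X i ord0 j = (M - m) * (\1_A w - fine (P A))}.
Proof.
move=> [_ /(_ i j)] + M m A; rewrite -/M -/m /=.
case: ifPn => [/eqP Mm P1|Mm [PM Pm]]; last first.
  have := two_valued_ae Mm PM Pm.
  apply: filterS => w ->.
  have -> : fine (P A) = (X i ord0 j - m) / (M - m)
    by exact: (congr1 fine PM).
  by have : M - m != 0; [rewrite subr_eq0|move=> Mm0; field].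
exists (~` [set w | Y i j w = X i ord0 j]).
have mS : measurable [set w | Y i j w = X i ord0 j].
  by have := @measurable_funPTI _ _ _ _ (Y i j) [set X i ord0 j]
    (measurable_set1 _).
split; first exact: measurableC.
  by rewrite probability_setC// P1 subee.
by apply: subsetC => w /= ->; rewrite -Mm !subrr mul0r.
Qed.

(** At a fixed coordinate, the events [Y i j = M i] are pairwise independent over the vectors [i],
    so the second moment formula applies with the ranges [M i - m i] as coefficients. *)
Lemma coordinate_error (n d : nat) (hd : (1 <= d)%N) (X : 'I_n -> 'rV[R]_d)
    (Y : 'I_n -> 'I_d -> {RV P >-> R}) j :
  stochastic_binary_quantization hd X Y ->
  (expectation P (fun w => ((\sum_i (Y i j w - X i ord0 j)) ^+ 2)%R) <=
   (2^-1 * \sum_i l2norm (X i) ^+ 2)%:E)%E.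
Proof.
move=> hY; have [indepY _] := hY.
pose M i := vmax hd (X i); pose m i := vmin hd (X i).
pose A i : set T := Y i j @^-1` [set M i].
have mA i : measurable (A i) by exact: measurable_funPTI.
have indepA i k : i != k -> P (A i `&` A k) = (P (A i) * P (A k))%E.
  move=> ik; have := mutually_independent_pair (i := (i, j)) (k := (k, j))
    (B := [set M i]) (C := [set M k]) indepY.
  by apply=> //; rewrite xpair_eqE (negbTE ik).
have -> : expectation P (fun w => (\sum_i (Y i j w - X i ord0 j)) ^+ 2) =
    expectation P (fun w =>
      (\sum_i (M i - m i) * (\1_(A i) w - fine (P (A i)))) ^+ 2).
  rewrite expectation.unlock; apply: ae_eq_integral => //.
  - apply/measurable_EFinP; apply: measurable_funX; apply: measurable_sum => i.
    exact: measurable_funB.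
  - apply/measurable_EFinP; apply: measurable_funX; apply: measurable_sum => i.
    by apply: measurable_funM => //; apply: measurable_funB => //;
      exact: measurable_indic.
  (* Finitely many almost sure identities hold simultaneously almost surely. *)
  - have := filter_forall (ae_filter_ringOfSetsType P)
      (fun i => quantization_ae i j hY).
    apply: filterS => w /= Yw _; congr (_ ^+ 2)%:E.
    by apply: eq_bigr => i _; rewrite Yw.
rewrite second_moment_centered_indic_sum// lee_fin mulr_sumr.
apply: ler_sum => i _; have := range_sqr_le hd (X i).
rewrite -/(M i) -/(m i); set p := fine _.
(* Since 4p(1 - p) = 1 - (2p - 1)^2, the variance is at most a quarter of the squared range, which
   [range_sqr_le] bounds by half of the squared norm. *)
have := sqr_ge0 (M i - m i); have := sqr_ge0 (2 * p - 1).
by nra.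
Qed.

End quantization.

Theorem lemma3 (R : realType) (n d : nat) (hn : (1 <= n)%N) (hd : (1 <= d)%N)
    (X : 'I_n -> 'rV[R]_d)
    (dT : measure_display) (T : measurableType dT) (P : probability T R)
    (Y : 'I_n -> 'I_d -> {RV P >-> R})
    (hY : stochastic_binary_quantization hd X Y) :
  (mean_squared_error P X (server_estimate Y) <=
   (d%:R / (2 * n%:R) * (n%:R^-1 * \sum_(i < n) l2norm (X i) ^+ 2))%:E)%E.
Proof.
have errE w : l2norm (server_estimate Y w - vmean X) ^+ 2 =
    n%:R^-1 ^+ 2 * \sum_j (\sum_i (Y i j w - X i ord0 j)) ^+ 2.
  rewrite l2norm_sqr mulr_sumr; apply: eq_bigr => j _.
  rewrite /server_estimate /vmean -scalerBr -sumrB -exprMn !mxE summxE.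
  by congr ((_ * _) ^+ 2); apply: eq_bigr => i _; rewrite !mxE.
have mS j : measurable_fun setT
    (fun w => ((\sum_i (Y i j w - X i ord0 j)) ^+ 2)%:E).
  apply/measurable_EFinP; apply: measurable_funX; apply: measurable_sum => i.
  exact: measurable_funB.
rewrite /mean_squared_error expectation.unlock.
under eq_integral do rewrite errE EFinM -sumEFin.
(* Nonnegativity of the squares lets the scalar and the sum over coordinates leave the integral. *)
rewrite ge0_integralZl//; first last.
- by move=> w _; apply: sume_ge0 => j _; rewrite lee_fin sqr_ge0.
- exact: emeasurable_sum.
rewrite ge0_integral_sum//; last by move=> j w _; rewrite lee_fin sqr_ge0.
set B := \sum_(i < n) _.
(* The factor [d] is spread out as a sum of equal terms over the coordinates, each to be matched
   with one use of [coordinate_error]. *)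
have -> : d%:R / (2 * n%:R) * (n%:R^-1 * B) =
    n%:R^-1 ^+ 2 * \sum_(j < d) (2^-1 * B).
  rewrite sumr_const card_ord -mulr_natl.
  have : n%:R != 0 :> R by rewrite pnatr_eq0 -lt0n.
  by move=> n0; field.
rewrite [leRHS]EFinM; apply: lee_wpmul2l.
  by rewrite lee_fin exprn_ge0 ?invr_ge0.
rewrite -sumEFin; apply: lee_sum => j _.
by have := coordinate_error j hY; rewrite expectation.unlock.
Qed.
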